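(* For every real number $x \in [\frac{1}{2}, \frac{3}{2}]$ there exist $a, b \in \mathrm{NICF}_5$ such that $a + b = x$.
   Context: NICF expansion: for real $x$, set $x_0=x$, $a_i=\lfloor x_i\rceil$ (nearest integer), $x_{i+1}=1/(x_i-a_i)$ while $x_i\ne a_i$; $x=[a_0;a_1,a_2,\ldots]$. $\mathrm{NICF}_5$ is the set of real numbers $x$ whose NICF expansion satisfies $|a_i|\le 5$ for all $i\ge 1$. *)

(* Defs.v *)
From Stdlib Require Import Reals ZArith.
Open Scope R_scope.

(* The nearest integer; a half-integer is rounded up, so that
   - 1/2 <= x - nearest_int x < 1/2. *)
Definition nearest_int (x : R) : Z := Zfloor (x + 1 / 2).

(* [nicf_rem x i] is x_i, and [None] once the expansion has stopped, that is
   when x_j is an integer for some j < i. *)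
Fixpoint nicf_rem (x : R) (i : nat) : option R :=
  match i with
  | O => Some x
  | S j =>
      match nicf_rem x j with
      | Some y =>
          if Req_EM_T y (IZR (nearest_int y)) then None
          else Some (1 / (y - IZR (nearest_int y)))
      | None => None
      end
  end.

Definition nicf_digit (x : R) (i : nat) : option Z :=
  option_map nearest_int (nicf_rem x i).

(* The digit a_0 is not constrained. *)
Definition NICF (N : Z) (x : R) : Prop :=
  forall (i : nat) (a : Z),
    (1 <= i)%nat -> nicf_digit x i = Some a -> (Z.abs a <= N)%Z.

(* Main.v *)
Require Import Defs.
From Stdlib Require Import Reals ZArith.
From Stdlib Require Import Lra Lia Classical.
Open Scope R_scope.

(** Allow the digits 5 and -5 only when the next remainder has the opposite
    sign.  Modulo integers the remainders then lie in the Cantor set C of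
    [m, 1 - m], m = 1/(5 - m), that is invariant under the maps
    x |-> 1/(k + 1 - x) and x |-> 1 - 1/(k + x) with k = 2, 3, 4, and
    C + C = [2m, 2 - 2m] contains [1/2, 3/2].

    To compute C + C, obtain C from [m, 1 - m] by removing one open gap at a
    time: the middle gap around 1/2, then in the lower half (the upper one is
    its mirror image) the gaps around 1/3 and 1/4, after which the pieces are
    Moebius images of [m, 1 - m].  Every gap is at most as long as each of the
    two intervals next to it and as the gap removed before it.  This survives
    the Moebius maps because their denominators vary by a factor at most 1 + d
    over a distance d.  So, given x in I + J, one may remove the larger of the
    gaps of I and J and keep x in the sum of the remaining pieces; the pieces
    shrink to points a and b with a + b = x. *)

(** * Nested intervals *)

Lemma nested_intervals (l h : nat -> R) :
  (forall n, l n <= l (S n)) -> (forall n, h (S n) <= h n) ->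
  (forall n, l n <= h n) ->
  exists a, forall n, l n <= a <= h n.
Proof.
  intros Hl Hh Hlh.
  assert (Ml : forall n k, l n <= l (k + n)%nat).
  { intros n k; induction k as [|k IH]; simpl; [lra | specialize (Hl (k + n)%nat); lra]. }
  assert (Mh : forall n k, h (k + n)%nat <= h n).
  { intros n k; induction k as [|k IH]; simpl; [lra | specialize (Hh (k + n)%nat); lra]. }
  assert (X : forall n k, l n <= h k).
  { intros n k. specialize (Ml n k). specialize (Mh k n). specialize (Hlh (k + n)%nat).
    rewrite (Nat.add_comm n k) in Mh. lra. }
  destruct (completeness (fun y => exists n, y = l n)) as [a [Ha1 Ha2]].
  - exists (h O). intros y [n ->]. apply X.
  - exists (l O); now exists O.
  - exists a. intros n; split.
    + apply Ha1; now exists n.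
    + apply Ha2. intros y [k ->]. apply X.
Qed.

(** * Sums of two points of a Cantor set *)

(* The left and right parts of a node are what remains of [lo, hi] when the
   gap (glo, ghi) is removed. *)
Record gap_tree := GapTree {
  node : Type;
  ok : node -> Prop;
  lo : node -> R; hi : node -> R; glo : node -> R; ghi : node -> R;
  left_part : node -> node; right_part : node -> node;
  ok_left : forall n, ok n -> ok (left_part n);
  ok_right : forall n, ok n -> ok (right_part n);
  lo_left : forall n, lo (left_part n) = lo n;
  hi_left : forall n, hi (left_part n) = glo n;
  lo_right : forall n, lo (right_part n) = ghi n;
  hi_right : forall n, hi (right_part n) = hi n;
  gap_pos : forall n, ok n -> 0 < ghi n - glo n;
  gap_le_left : forall n, ok n -> ghi n - glo n <= glo n - lo n;
  gap_le_right : forall n, ok n -> ghi n - glo n <= hi n - ghi n;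
  gap_left_le : forall n, ok n ->
    ghi (left_part n) - glo (left_part n) <= ghi n - glo n;
  gap_right_le : forall n, ok n ->
    ghi (right_part n) - glo (right_part n) <= ghi n - glo n;
  size_bound : R;
  size_le_gap : forall n, ok n -> hi n - lo n <= size_bound * (ghi n - glo n)
}.

Arguments ok {_} _. Arguments lo {_} _. Arguments hi {_} _.
Arguments glo {_} _. Arguments ghi {_} _.
Arguments left_part {_} _. Arguments right_part {_} _.

Definition gap {T : gap_tree} (n : node T) := ghi n - glo n.
Definition len {T : gap_tree} (n : node T) := hi n - lo n.

(** Only finitely many levels are inspected, so a point of the Cantor set under [n] is one that
    survives for every [k], and no infinite branch has to be named. *)
Fixpoint survives {T : gap_tree} (k : nat) (n : node T) (a : R) : Prop :=
  lo n <= a <= hi n /\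
  match k with
  | O => True
  | S k => survives k (left_part n) a \/ survives k (right_part n) a
  end.

(* Splitting the node with the larger gap keeps each gap no longer than the
   other interval, so no part of the sum is lost. *)
Definition split {T : gap_tree} (x : R) (s : node T * node T) :=
  let (I, J) := s in
  if Rle_dec (gap J) (gap I) then
    if Rle_dec x (glo I + hi J) then (left_part I, J) else (right_part I, J)
  else
    if Rle_dec x (hi I + glo J) then (I, left_part J) else (I, right_part J).

Definition linked {T : gap_tree} (x : R) (s : node T * node T) :=
  let (I, J) := s in
  ok I /\ ok J /\ lo I + lo J <= x <= hi I + hi J /\
  gap I <= len J /\ gap J <= len I.

Definition part {T : gap_tree} (n' n : node T) :=
  n' = left_part n \/ n' = right_part n.

Lemma split_cases {T : gap_tree} x (I J : node T) :
  (snd (split x (I, J)) = J /\ part (fst (split x (I, J))) I) \/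
  (fst (split x (I, J)) = I /\ part (snd (split x (I, J))) J).
Proof.
  unfold split, part.
  destruct (Rle_dec _ _); destruct (Rle_dec _ _); simpl; auto.
Qed.

(** Say [gap J <= gap I]. Since [gap I <= len J], the sums of [J] with the two parts of [I] leave no
    hole, so [x] stays in one of them. The new gap in [I] is at most [gap I <= len J], and
    [gap J <= gap I] is at most the length of either part. *)
Lemma split_linked {T : gap_tree} x (s : node T * node T) :
  linked x s -> linked x (split x s).
Proof.
  destruct s as [I J]. intros (oI & oJ & Hx & H1 & H2).
  unfold split, linked, gap, len in *.
  pose proof (gap_le_left T I oI). pose proof (gap_le_right T I oI).
  pose proof (gap_le_left T J oJ). pose proof (gap_le_right T J oJ).
  pose proof (gap_left_le T I oI). pose proof (gap_right_le T I oI).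
  pose proof (gap_left_le T J oJ). pose proof (gap_right_le T J oJ).
  destruct (Rle_dec _ _); destruct (Rle_dec _ _);
  rewrite ?lo_left, ?hi_left, ?lo_right, ?hi_right;
  (repeat split; auto using ok_left, ok_right; lra).
Qed.

Lemma part_props {T : gap_tree} (n' n : node T) :
  ok n -> part n' n ->
  lo n <= lo n' /\ hi n' <= hi n /\ 0 <= len n' /\ len n' <= len n - gap n.
Proof.
  intros o H. unfold len, gap.
  pose proof (gap_le_left T n o). pose proof (gap_le_right T n o).
  pose proof (gap_pos T n o).
  destruct H as [-> | ->];
  rewrite ?lo_left, ?hi_left, ?lo_right, ?hi_right; repeat split; lra.
Qed.

Lemma len_gt_gap {T : gap_tree} (n : node T) : ok n -> 0 < gap n < len n.
Proof.
  intros o. unfold len, gap.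
  pose proof (gap_le_left T n o). pose proof (gap_le_right T n o).
  pose proof (gap_pos T n o). lra.
Qed.

Lemma size_bound_gt1 {T : gap_tree} (n : node T) : ok n -> 1 < size_bound T.
Proof.
  intros o. pose proof (len_gt_gap n o). pose proof (size_le_gap T n o).
  unfold len, gap in *. nra.
Qed.

(** The product of the lengths measures progress whichever node is split: a gap takes at least the
    fraction [/ size_bound T] of its node. *)
Lemma split_area {T : gap_tree} x (s : node T * node T) :
  linked x s ->
  len (fst (split x s)) * len (snd (split x s)) <=
  (1 - / size_bound T) * (len (fst s) * len (snd s)).
Proof.
  destruct s as [I J]. intros L. destruct L as (oI & oJ & _).
  pose proof (size_bound_gt1 I oI) as K1.
  assert (S : forall n : node T, ok n ->
    len n - gap n <= (1 - / size_bound T) * len n).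
  { intros n o. pose proof (size_le_gap T n o) as h. fold (gap n) (len n) in h.
    assert (/ size_bound T * len n <= gap n); [|lra].
    apply (Rmult_le_reg_l (size_bound T)); [lra|].
    rewrite <- Rmult_assoc, Rinv_r by lra. lra. }
  pose proof (len_gt_gap I oI). pose proof (len_gt_gap J oJ).
  pose proof (S I oI). pose proof (S J oJ).
  destruct (split_cases x I J) as [[E P] | [E P]]; rewrite E; cbn [fst snd].
  - destruct (part_props _ _ oI P) as (_ & _ & P0 & P1).
    rewrite <- Rmult_assoc. apply Rmult_le_compat_r; lra.
  - destruct (part_props _ _ oJ P) as (_ & _ & P0 & P1).
    apply Rle_trans with (len I * ((1 - / size_bound T) * len J)); [|right; ring].
    apply Rmult_le_compat_l; lra.
Qed.

(** Linked nodes have comparable lengths, as [len I <= size_bound T * gap I <= size_bound T * len J]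
    and symmetrically. A small product therefore makes both lengths small. *)
Lemma linked_len {T : gap_tree} x (s : node T * node T) :
  linked x s ->
  len (fst s) ^ 2 <= size_bound T * (len (fst s) * len (snd s)) /\
  len (snd s) ^ 2 <= size_bound T * (len (fst s) * len (snd s)).
Proof.
  destruct s as [I J]. intros (oI & oJ & _ & H1 & H2). simpl fst; simpl snd.
  pose proof (size_bound_gt1 I oI) as K1.
  pose proof (len_gt_gap I oI). pose proof (len_gt_gap J oJ).
  pose proof (size_le_gap T I oI) as hI. fold (gap I) (len I) in hI.
  pose proof (size_le_gap T J oJ) as hJ. fold (gap J) (len J) in hJ.
  assert (len I <= size_bound T * len J) by nra.
  assert (len J <= size_bound T * len I) by nra.
  split; nra.
Qed.

Fixpoint splits {T : gap_tree} (x : R) (s : node T * node T) (t : nat) :=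
  match t with O => s | S t => split x (splits x s t) end.

Lemma splits_linked {T : gap_tree} x (s : node T * node T) t :
  linked x s -> linked x (splits x s t).
Proof.
  intros H; induction t as [|t IH]; simpl; auto using split_linked.
Qed.

Lemma splits_small {T : gap_tree} x (s : node T * node T) eps :
  linked x s -> 0 < eps ->
  exists t0, forall t, (t0 <= t)%nat ->
    len (fst (splits x s t)) < eps /\ len (snd (splits x s t)) < eps.
Proof.
  intros L He.
  assert (K1 : 1 < size_bound T).
  { destruct s as [I J]; destruct L as (oI & _). exact (size_bound_gt1 I oI). }
  set (r := 1 - / size_bound T).
  assert (Hr : 0 <= r < 1).
  { unfold r. pose proof (Rinv_0_lt_compat (size_bound T) ltac:(lra)).
    assert (/ size_bound T < / 1) by (apply Rinv_lt_contravar; lra). lra. }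
  set (A := len (fst s) * len (snd s)).
  assert (A0 : 0 < A).
  { unfold A. destruct s as [I J]; destruct L as (oI & oJ & _). simpl.
    pose proof (len_gt_gap I oI). pose proof (len_gt_gap J oJ). nra. }
  assert (HA : forall t,
    len (fst (splits x s t)) * len (snd (splits x s t)) <= r ^ t * A).
  { induction t as [|t IH]; simpl.
    - unfold A; lra.
    - pose proof (split_area x _ (splits_linked x s t L)) as h. fold r in h. nra. }
  assert (KA : 0 < size_bound T * A) by nra.
  (* Chosen so that [size_bound T * r ^ t * A < eps ^ 2], which bounds the squares of both
     lengths. *)
  destruct (pow_lt_1_zero r ltac:(rewrite Rabs_pos_eq; lra)
              (eps ^ 2 / (size_bound T * A))) as [t0 Ht0].
  { apply Rdiv_lt_0_compat; nra. }
  exists t0. intros t Ht. specialize (Ht0 t Ht). specialize (HA t).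
  rewrite Rabs_pos_eq in Ht0 by (apply pow_le; lra).
  apply (Rmult_lt_compat_r (size_bound T * A)) in Ht0; [|exact KA].
  unfold Rdiv in Ht0. rewrite Rmult_assoc, Rinv_l, Rmult_1_r in Ht0 by lra.
  pose proof (linked_len x _ (splits_linked x s t L)) as [B1 B2].
  split; nra.
Qed.

(** The sequence may pause at a node while the other summand is being split, but lengths tending to
    0 force every node to be left eventually, and then for one of its parts. *)
Lemma survives_chain {T : gap_tree} (I : nat -> node T) a :
  (forall t, lo (I t) <= a <= hi (I t)) ->
  (forall t, 0 < len (I t)) ->
  (forall t, I (S t) = I t \/ part (I (S t)) (I t)) ->
  (forall eps, 0 < eps -> exists t0, forall t, (t0 <= t)%nat -> len (I t) < eps) ->
  forall k t, survives k (I t) a.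
Proof.
  intros Ha Hpos Hstep Hsmall k. induction k as [|k IH]; intros t; simpl.
  - auto.
  - split; [apply Ha|].
    assert (E : exists s, I s = I t /\ part (I (S s)) (I t)).
    (* Otherwise the sequence is constant from [t] on, with a fixed positive length. *)
    { apply NNPP; intros N.
      assert (C : forall j, I (j + t)%nat = I t).
      { induction j as [|j IHj]; simpl; [reflexivity|].
        destruct (Hstep (j + t)%nat) as [E | P]; [congruence|].
        exfalso; apply N. exists (j + t)%nat. rewrite IHj in P. auto. }
      destruct (Hsmall (len (I t)) (Hpos t)) as [t0 Ht0].
      specialize (Ht0 (t0 + t)%nat ltac:(lia)). rewrite C in Ht0. lra. }
    destruct E as (s & _ & [E | E]); rewrite <- E; auto.
Qed.

Lemma sum_of_survivors {T : gap_tree} (x : R) (I J : node T) :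
  linked x (I, J) ->
  exists a b, (forall k, survives k I a) /\ (forall k, survives k J b) /\ a + b = x.
Proof.
  intros L. set (s := splits x (I, J)).
  assert (Ls : forall t, linked x (s t)) by (intros t; apply splits_linked, L).
  assert (St : forall t,
    (snd (s (S t)) = snd (s t) /\ part (fst (s (S t))) (fst (s t))) \/
    (fst (s (S t)) = fst (s t) /\ part (snd (s (S t))) (snd (s t)))).
  { intros t. change (s (S t)) with (split x (s t)).
    destruct (s t) as [I' J']. apply split_cases. }
  assert (Ok : forall t, ok (fst (s t)) /\ ok (snd (s t))).
  { intros t. specialize (Ls t). destruct (s t); simpl. unfold linked in Ls; tauto. }
  assert (S1 : forall t, fst (s (S t)) = fst (s t) \/ part (fst (s (S t))) (fst (s t)))
    by (intros t; specialize (St t); tauto).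
  assert (S2 : forall t, snd (s (S t)) = snd (s t) \/ part (snd (s (S t))) (snd (s t)))
    by (intros t; specialize (St t); tauto).
  assert (limit : forall n : nat -> node T,
    (forall t, ok (n t)) -> (forall t, n (S t) = n t \/ part (n (S t)) (n t)) ->
    exists a, forall t, lo (n t) <= a <= hi (n t)).
  { intros n On Sn. apply (nested_intervals (fun t => lo (n t)) (fun t => hi (n t)));
    intros t; pose proof (part_props (n (S t)) (n t) (On t)) as P;
    pose proof (len_gt_gap (n t) (On t)) as G; unfold len in *;
    destruct (Sn t) as [E | Q]; try rewrite E; try specialize (P Q); lra. }
  destruct (limit (fun t => fst (s t)) (fun t => proj1 (Ok t)) S1) as [a Ha].
  destruct (limit (fun t => snd (s t)) (fun t => proj2 (Ok t)) S2) as [b Hb].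
  assert (P1 : forall t, 0 < len (fst (s t)))
    by (intros t; pose proof (len_gt_gap _ (proj1 (Ok t))); lra).
  assert (P2 : forall t, 0 < len (snd (s t)))
    by (intros t; pose proof (len_gt_gap _ (proj2 (Ok t))); lra).
  assert (Sm : forall eps, 0 < eps -> exists t0, forall t, (t0 <= t)%nat ->
    len (fst (s t)) < eps /\ len (snd (s t)) < eps)
    by (intros eps He; now apply splits_small).
  exists a, b. split; [|split].
  - intros k. apply (survives_chain (fun t => fst (s t)) a Ha P1 S1) with (t := O).
    intros eps He. destruct (Sm eps He) as [t0 Ht]. exists t0. intros t h. now apply Ht.
  - intros k. apply (survives_chain (fun t => snd (s t)) b Hb P2 S2) with (t := O).
    intros eps He. destruct (Sm eps He) as [t0 Ht]. exists t0. intros t h. now apply Ht.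
  (* Both [a + b] and [x] lie in the sum of the two current intervals, whose length is below
     [eps]. *)
  - apply cond_eq. intros eps He.
    destruct (Sm (eps / 2) ltac:(lra)) as [t0 Ht]. destruct (Ht t0 (le_n _)) as [h1 h2].
    specialize (Ha t0); specialize (Hb t0); specialize (Ls t0).
    destruct (s t0) as [I' J']. destruct Ls as (_ & _ & Hx & _).
    simpl in *. unfold len in *. apply Rabs_def1; lra.
Qed.

(** * Increasing Moebius maps of bounded distortion *)

Definition affine (e0 e1 x : R) := e0 * (1 - x) + e1 * x.

(* For a Moebius map of determinant 1 with denominator [affine e0 e1]. *)
Definition mobius_diff (e0 e1 : R) (g : R -> R) :=
  forall x y, 0 <= x <= 1 -> 0 <= y <= 1 ->
    g y - g x = (y - x) / (affine e0 e1 x * affine e0 e1 y).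

(** The factor 2 between the end values of the denominator is what bounds distortion, and it is
    inherited under the digit maps. The second clause, surjectivity onto [[g 0, g 1]], replaces a
    continuity argument. *)
Definition tame (g : R -> R) :=
  (exists e0 e1, 0 < e0 <= 2 * e1 /\ 0 < e1 <= 2 * e0 /\ mobius_diff e0 e1 g) /\
  (forall a, g 0 <= a <= g 1 -> exists x, 0 <= x <= 1 /\ a = g x).

Lemma affine_pos e0 e1 x : 0 < e0 -> 0 < e1 -> 0 <= x <= 1 -> 0 < affine e0 e1 x.
Proof. intros. unfold affine. nra. Qed.

(** The factor 2 gives that the slope [e1 - e0] is in absolute value at most the smaller of [e0] and
    [e1], hence at most the value at any point of [[0, 1]]. *)
Lemma affine_distortion e0 e1 x y s :
  0 < e0 <= 2 * e1 -> 0 < e1 <= 2 * e0 -> 0 <= y <= 1 -> -s <= x - y <= s ->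
  affine e0 e1 x <= (1 + s) * affine e0 e1 y.
Proof.
  intros H0 H1 Hy Hs.
  assert (D : Rabs (e1 - e0) <= affine e0 e1 y).
  { apply Rabs_le. unfold affine. nra. }
  replace (affine e0 e1 x) with (affine e0 e1 y + (e1 - e0) * (x - y))
    by (unfold affine; ring).
  assert ((e1 - e0) * (x - y) <= Rabs (e1 - e0) * s).
  { eapply Rle_trans; [apply Rle_abs|]. rewrite Rabs_mult.
    apply Rmult_le_compat_l; [apply Rabs_pos | apply Rabs_le; lra]. }
  nra.
Qed.

Lemma tame_increasing g x y :
  tame g -> 0 <= x <= 1 -> 0 <= y <= 1 -> x < y -> g x < g y.
Proof.
  intros [(e0 & e1 & H0 & H1 & D) _] Hx Hy Hxy.
  assert (0 < g y - g x); [|lra].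
  rewrite D by assumption. apply Rdiv_lt_0_compat; [lra|].
  apply Rmult_lt_0_compat; apply affine_pos; tauto.
Qed.

Lemma tame_le_reg g x y :
  tame g -> 0 <= x <= 1 -> 0 <= y <= 1 -> g x <= g y -> x <= y.
Proof.
  intros Hg Hx Hy H. destruct (Rle_or_lt x y) as [|h]; [assumption|].
  pose proof (tame_increasing g y x Hg Hy Hx h). lra.
Qed.

(** The image of [[u, v]] has length [(v - u) / (U * V)]. Moving the ends to [p] and [q] changes the
    two denominators by factors at most [1 + s] and [1 + t], so a comparison of lengths with that
    margin passes to the images. *)
Lemma tame_compare g K s t u v p q :
  tame g -> 0 <= u <= 1 -> 0 <= v <= 1 -> 0 <= p <= 1 -> 0 <= q <= 1 -> u <= v ->
  -s <= p - u <= s -> -t <= q - v <= t ->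
  (v - u) * ((1 + s) * (1 + t)) <= K * (q - p) ->
  g v - g u <= K * (g q - g p).
Proof.
  intros [(e0 & e1 & H0 & H1 & D) _] Hu Hv Hp Hq Huv Hs Ht HK.
  rewrite (D u v), (D p q) by assumption.
  pose proof (affine_distortion e0 e1 p u s H0 H1 Hu Hs) as B1.
  pose proof (affine_distortion e0 e1 q v t H0 H1 Hv Ht) as B2.
  pose proof (affine_pos e0 e1 u (proj1 H0) (proj1 H1) Hu) as pu.
  pose proof (affine_pos e0 e1 v (proj1 H0) (proj1 H1) Hv) as pv.
  pose proof (affine_pos e0 e1 p (proj1 H0) (proj1 H1) Hp) as pp.
  pose proof (affine_pos e0 e1 q (proj1 H0) (proj1 H1) Hq) as pq.
  set (U := affine e0 e1 u) in *. set (V := affine e0 e1 v) in *.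
  set (P := affine e0 e1 p) in *. set (Q := affine e0 e1 q) in *.
  apply (Rmult_le_reg_r (U * V * (P * Q))).
  { repeat apply Rmult_lt_0_compat; assumption. }
  replace ((v - u) / (U * V) * (U * V * (P * Q))) with ((v - u) * (P * Q))
    by (field; lra).
  replace (K * ((q - p) / (P * Q)) * (U * V * (P * Q))) with (K * (q - p) * (U * V))
    by (field; lra).
  assert (P * Q <= ((1 + s) * U) * ((1 + t) * V)) by (apply Rmult_le_compat; lra).
  apply Rle_trans with ((v - u) * (((1 + s) * U) * ((1 + t) * V))).
  { apply Rmult_le_compat_l; lra. }
  replace ((v - u) * ((1 + s) * U * ((1 + t) * V)))
    with ((v - u) * ((1 + s) * (1 + t)) * (U * V)) by ring.
  apply Rmult_le_compat_r; [|assumption]. left; now apply Rmult_lt_0_compat.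
Qed.

Lemma tame_id : tame (fun x => x).
Proof.
  split.
  - exists 1, 1. repeat split; try lra. intros x y _ _. unfold affine. field. lra.
  - intros a Ha. exists a. auto.
Qed.

(** * The digit maps *)

Definition psi (k x : R) := 1 / (k + 1 - x).
Definition chi (k x : R) := 1 - 1 / (k + x).

Lemma inv_bounds a b z : 0 < a -> a <= z <= b -> 1 / b <= 1 / z <= 1 / a.
Proof.
  intros Ha [H1 H2]. unfold Rdiv. rewrite !Rmult_1_l.
  split; apply Rinv_le_contravar; lra.
Qed.

Lemma psi_unit k x : 2 <= k -> 0 <= x <= 1 -> 0 <= psi k x <= 1.
Proof.
  intros Hk Hx. unfold psi.
  pose proof (inv_bounds 1 (k + 1) (k + 1 - x) ltac:(lra) ltac:(lra)).
  pose proof (Rdiv_lt_0_compat 1 (k + 1) ltac:(lra) ltac:(lra)). lra.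
Qed.

(** Conjugation by [x |-> 1 - x] reduces facts about [chi] to facts about [psi]. *)
Lemma chi_flip k x : chi k x = 1 - psi k (1 - x).
Proof. unfold chi, psi. now replace (k + 1 - (1 - x)) with (k + x) by ring. Qed.

Lemma chi_unit k x : 2 <= k -> 0 <= x <= 1 -> 0 <= chi k x <= 1.
Proof.
  intros Hk Hx. rewrite chi_flip.
  pose proof (psi_unit k (1 - x) Hk ltac:(lra)). lra.
Qed.

Lemma tame_psi g k : 2 <= k -> tame g -> tame (fun x => g (psi k x)).
Proof.
  intros Hk Hg. pose proof Hg as [(e0 & e1 & H0 & H1 & D) S]. split.
  (* The denominator of [g] at [psi k z], multiplied by [k + 1 - z], is again affine in [z], with
     these values at 0 and 1. Their ratio stays within 2 because [k <= 2 * (k - 1)]. *)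
  - exists (e1 + k * e0), (e1 + (k - 1) * e0). split; [nra|]. split; [nra|].
    intros x y Hx Hy. rewrite (D _ _ (psi_unit k x Hk Hx) (psi_unit k y Hk Hy)).
    assert (A : forall z, 0 <= z <= 1 -> affine e0 e1 (psi k z) =
      affine (e1 + k * e0) (e1 + (k - 1) * e0) z / (k + 1 - z)).
    { intros z Hz. unfold affine, psi. field. lra. }
    rewrite !A by assumption.
    pose proof (affine_pos (e1 + k * e0) (e1 + (k - 1) * e0) x ltac:(nra) ltac:(nra) Hx).
    pose proof (affine_pos (e1 + k * e0) (e1 + (k - 1) * e0) y ltac:(nra) ltac:(nra) Hy).
    unfold psi. field. lra.
  - intros a Ha.
    pose proof (psi_unit k 0 Hk ltac:(lra)) as U0.
    pose proof (psi_unit k 1 Hk ltac:(lra)) as U1.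
    assert (M : forall x y, 0 <= x <= 1 -> 0 <= y <= 1 -> x <= y -> g x <= g y).
    { intros x y Hx Hy [h | ->]; [|lra]. left; now apply tame_increasing. }
    destruct (S a) as (z & Hz & ->).
    { pose proof (M 0 (psi k 0) ltac:(lra) U0 ltac:(lra)).
      pose proof (M (psi k 1) 1 U1 ltac:(lra) ltac:(lra)). lra. }
    destruct Ha as [Ha0 Ha1].
    apply (tame_le_reg g _ _ Hg U0 Hz) in Ha0. apply (tame_le_reg g _ _ Hg Hz U1) in Ha1.
    unfold psi in Ha0, Ha1.
    assert (P0 : 0 < 1 / (k + 1 - 0)) by (apply Rdiv_lt_0_compat; lra).
    pose proof (inv_bounds _ _ z P0 (conj Ha0 Ha1)) as B.
    replace (1 / (1 / (k + 1 - 1))) with k in B by (field; lra).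
    replace (1 / (1 / (k + 1 - 0))) with (k + 1) in B by (field; lra).
    (* The solution of [psi k x = z]. *)
    exists (k + 1 - 1 / z). split; [lra|]. f_equal. unfold psi. field. lra.
Qed.

Lemma tame_flip g : tame g -> tame (fun x => 1 - g (1 - x)).
Proof.
  intros [(e0 & e1 & H0 & H1 & D) S]. split.
  - exists e1, e0. split; [assumption|]. split; [assumption|]. intros x y Hx Hy.
    replace (1 - g (1 - y) - (1 - g (1 - x))) with (g (1 - x) - g (1 - y)) by ring.
    rewrite D by lra. unfold affine.
    replace (1 - x - (1 - y)) with (y - x) by ring. f_equal. ring.
  - intros a Ha. rewrite Rminus_0_r, Rminus_diag in Ha.
    destruct (S (1 - a) ltac:(lra)) as (z & Hz & E).
    exists (1 - z). split; [lra|]. replace (1 - (1 - z)) with z by ring. lra.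
Qed.

Lemma tame_ext g h : (forall x, g x = h x) -> tame g -> tame h.
Proof.
  intros E [(e0 & e1 & H0 & H1 & D) S]. split.
  - exists e0, e1. split; [assumption|]. split; [assumption|].
    intros x y Hx Hy. rewrite <- !E. now apply D.
  - intros a. rewrite <- !E. intros Ha. destruct (S a Ha) as (x & Hx & ->).
    exists x. auto.
Qed.

Lemma tame_chi g k : 2 <= k -> tame g -> tame (fun x => g (chi k x)).
Proof.
  intros Hk Hg.
  apply (tame_ext (fun x => 1 - (1 - g (1 - psi k (1 - x))))).
  { intros x. rewrite chi_flip. ring. }
  apply (tame_flip (fun x => 1 - g (1 - psi k x))).
  apply (tame_psi (fun x => 1 - g (1 - x)) k Hk). now apply tame_flip.
Qed.

(** * The Cantor set of restricted expansions *)

(* The root in [0, 1/2] of m = 1/(5 - m).  Since m^2 = 5m - 1, the reciprocals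
   of 2 + m, 3 - m, 3 + m, 4 - m and 4 + m are affine in m. *)
Definition m := (5 - sqrt 21) / 2.

Lemma m_sqr : m * m = 5 * m - 1.
Proof. unfold m. pose proof (sqrt_sqrt 21 ltac:(lra)). nra. Qed.

Lemma m_bounds : 0.2087 < m < 0.2088.
Proof.
  unfold m. pose proof (sqrt_sqrt 21 ltac:(lra)). pose proof (sqrt_pos 21). nra.
Qed.

(** [Low] lies below the middle gap and [Lowest] below the gap around 1/3 as well; [High] and
    [Highest] are their mirror images. *)
Inductive kind := Whole | Low | Lowest | High | Highest.

(** All end points are the values of [psi 2], [psi 3], [psi 4] at [m] and [1 - m], or their mirror
    images, written affinely in [m] so that linear arithmetic applies. *)
Definition klo (c : kind) := match c with
  | Whole | Low | Lowest => m
  | High => 1 - (7 - m) / 15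
  | Highest => 1 - (8 - m) / 25 end.
Definition khi (c : kind) := match c with
  | Whole | High | Highest => 1 - m
  | Low => (7 - m) / 15
  | Lowest => (8 - m) / 25 end.
Definition kglo (c : kind) := match c with
  | Whole => (7 - m) / 15
  | Low => (8 - m) / 25
  | Lowest => (9 - m) / 37
  | High => 1 - (2 - m) / 5
  | Highest => 1 - (1 - m) / 3 end.
Definition kghi (c : kind) := match c with
  | Whole => 1 - (7 - m) / 15
  | Low => (2 - m) / 5
  | Lowest => (1 - m) / 3
  | High => 1 - (8 - m) / 25
  | Highest => 1 - (9 - m) / 37 end.

(* A node (c, g) is the image under g of the part c of [m, 1 - m]. *)
Definition cnode := (kind * (R -> R))%type.

Definition cleft (n : cnode) : cnode := let (c, g) := n in match c with
  | Whole => (Low, g)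
  | Low => (Lowest, g)
  | Lowest => (Whole, fun x => g (psi 4 x))
  | High => (Whole, fun x => g (chi 2 x))
  | Highest => (Whole, fun x => g (chi 3 x)) end.
Definition cright (n : cnode) : cnode := let (c, g) := n in match c with
  | Whole => (High, g)
  | Low => (Whole, fun x => g (psi 2 x))
  | Lowest => (Whole, fun x => g (psi 3 x))
  | High => (Highest, g)
  | Highest => (Whole, fun x => g (chi 4 x)) end.

Definition at_end (e : kind -> R) (n : cnode) := snd n (e (fst n)).

Ltac reciprocal := unfold psi, chi; pose proof m_sqr; pose proof m_bounds;
  match goal with |- context [1 / ?d] =>
    apply (Rmult_eq_reg_r d); [|lra]; field_simplify; [nra|lra] end.

Lemma psi2_m : psi 2 m = (2 - m) / 5. Proof. reciprocal. Qed.
Lemma psi2_1m : psi 2 (1 - m) = (7 - m) / 15. Proof. reciprocal. Qed.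
Lemma psi3_m : psi 3 m = (1 - m) / 3. Proof. reciprocal. Qed.
Lemma psi3_1m : psi 3 (1 - m) = (8 - m) / 25. Proof. reciprocal. Qed.
Lemma psi4_m : psi 4 m = m. Proof. reciprocal. Qed.
Lemma psi4_1m : psi 4 (1 - m) = (9 - m) / 37. Proof. reciprocal. Qed.
Lemma chi_m k : chi k m = 1 - psi k (1 - m). Proof. apply chi_flip. Qed.
Lemma chi_1m k : chi k (1 - m) = 1 - psi k m.
Proof. rewrite chi_flip. do 2 f_equal. ring. Qed.

Ltac ends n :=
  destruct n as [[] g]; unfold at_end;
  cbn [fst snd cleft cright klo khi kglo kghi];
  rewrite ?chi_m, ?chi_1m, ?psi2_m, ?psi2_1m, ?psi3_m, ?psi3_1m, ?psi4_m, ?psi4_1m; reflexivity.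

Lemma cleft_lo n : at_end klo (cleft n) = at_end klo n. Proof. ends n. Qed.
Lemma cleft_hi n : at_end khi (cleft n) = at_end kglo n. Proof. ends n. Qed.
Lemma cright_lo n : at_end klo (cright n) = at_end kghi n. Proof. ends n. Qed.
Lemma cright_hi n : at_end khi (cright n) = at_end khi n. Proof. ends n. Qed.

Lemma tame_cleft n : tame (snd n) -> tame (snd (cleft n)).
Proof.
  destruct n as [[] g]; simpl; intros H; trivial;
  try (apply tame_psi; [lra | assumption]); apply tame_chi; (lra || assumption).
Qed.

Lemma tame_cright n : tame (snd n) -> tame (snd (cright n)).
Proof.
  destruct n as [[] g]; simpl; intros H; trivial;
  try (apply tame_psi; [lra | assumption]); apply tame_chi; (lra || assumption).
Qed.

(** * Gap inequalities for the Cantor set *)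

Lemma cgap_pos n : tame (snd n) -> 0 < at_end kghi n - at_end kglo n.
Proof.
  intros H. pose proof m_bounds. unfold at_end.
  pose proof (tame_increasing (snd n) (kglo (fst n)) (kghi (fst n)) H) as P.
  destruct n as [[] g]; simpl in *; specialize (P ltac:(lra) ltac:(lra) ltac:(lra)); lra.
Qed.

Lemma cgap_le_left n : tame (snd n) ->
  at_end kghi n - at_end kglo n <= at_end kglo n - at_end klo n.
Proof.
  intros H. pose proof m_bounds. unfold at_end.
  destruct n as [c g]; simpl in *.
  rewrite <- (Rmult_1_l (g (kglo c) - _)).
  (* The margins are the exact displacements of the two ends from the gap to the interval on its
     left. *)
  apply (tame_compare g 1 (kglo c - klo c) (kghi c - kglo c) _ _ _ _ H);
  destruct c; simpl; try lra; nra.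
Qed.

Lemma cgap_le_right n : tame (snd n) ->
  at_end kghi n - at_end kglo n <= at_end khi n - at_end kghi n.
Proof.
  intros H. pose proof m_bounds. unfold at_end.
  destruct n as [c g]; simpl in *.
  rewrite <- (Rmult_1_l (g (khi c) - _)).
  apply (tame_compare g 1 (kghi c - kglo c) (khi c - kghi c) _ _ _ _ H);
  destruct c; simpl; try lra; nra.
Qed.

Lemma csize_le_gap n : tame (snd n) ->
  at_end khi n - at_end klo n <= 12 * (at_end kghi n - at_end kglo n).
Proof.
  intros H. pose proof m_bounds. unfold at_end.
  destruct n as [c g]; simpl in *.
  (* Each end moves by less than 1/4. The worst ratio of length to gap is about 6.2, for [Whole];
     times 25/16 it stays below 10. *)
  apply (tame_compare g 12 (1/4) (1/4) _ _ _ _ H);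
  destruct c; simpl; try lra; nra.
Qed.

(** Serves the case where a part is a new [Whole] node: its middle gap is compared with the parent
    gap [(p, q)]. The constant 0.121 is the distortion [(11/10)^2] times 0.1, a bound for the length
    of the middle gap of [[m, 1 - m]]. *)
Lemma psi_middle_gap k g p q :
  tame g -> 2 <= k -> 0 <= p <= q -> q <= 1 ->
  -(1/10) <= p - psi k ((7 - m) / 15) <= 1/10 ->
  -(1/10) <= q - psi k (1 - (7 - m) / 15) <= 1/10 ->
  0.121 <= (q - p) * ((k + 0.45) * (k + 0.54)) ->
  g (psi k (1 - (7 - m) / 15)) - g (psi k ((7 - m) / 15)) <= g q - g p.
Proof.
  intros Hg Hk Hp Hq Bp Bq HK. pose proof m_bounds.
  set (M := (7 - m) / 15) in *. assert (HM : 0.452 < M < 0.453) by (unfold M; lra).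
  rewrite <- (Rmult_1_l (g q - g p)).
  assert (E : psi k (1 - M) - psi k M = (1 - 2 * M) / ((k + M) * (k + 1 - M))).
  { unfold psi. field. lra. }
  apply (tame_compare g 1 (1/10) (1/10) _ _ _ _ Hg); try lra;
    try (apply psi_unit; lra).
  - assert (0 < psi k (1 - M) - psi k M); [|lra].
    rewrite E. apply Rdiv_lt_0_compat; nra.
  - rewrite E. apply (Rmult_le_reg_r ((k + M) * (k + 1 - M))); [nra|].
    replace ((1 - 2 * M) / ((k + M) * (k + 1 - M)) * ((1 + 1/10) * (1 + 1/10)) *
      ((k + M) * (k + 1 - M))) with (121/100 * (1 - 2 * M)) by (field; lra).
    assert ((k + 0.45) * (k + 0.54) <= (k + M) * (k + 1 - M)) by nra.
    assert ((q - p) * ((k + 0.45) * (k + 0.54)) <= (q - p) * ((k + M) * (k + 1 - M)))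
      by (apply Rmult_le_compat_l; lra).
    lra.
Qed.

Lemma chi_middle_gap k g p q :
  tame g -> 2 <= k -> 0 <= p <= q -> q <= 1 ->
  -(1/10) <= p - psi k ((7 - m) / 15) <= 1/10 ->
  -(1/10) <= q - psi k (1 - (7 - m) / 15) <= 1/10 ->
  0.121 <= (q - p) * ((k + 0.45) * (k + 0.54)) ->
  g (chi k (1 - (7 - m) / 15)) - g (chi k ((7 - m) / 15)) <= g (1 - p) - g (1 - q).
Proof.
  intros Hg Hk Hp Hq Bp Bq HK.
  pose proof (psi_middle_gap k _ p q (tame_flip g Hg) Hk Hp Hq Bp Bq HK) as P.
  rewrite !chi_flip. replace (1 - (1 - (7 - m) / 15)) with ((7 - m) / 15) by ring.
  cbv beta in P. lra.
Qed.

Lemma psi_middle_bounds k : 2 <= k ->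
  1 / (k + 0.548) <= psi k ((7 - m) / 15) <= 1 / (k + 0.547) /\
  1 / (k + 0.453) <= psi k (1 - (7 - m) / 15) <= 1 / (k + 0.452).
Proof.
  intros Hk. pose proof m_bounds. split; apply inv_bounds; lra.
Qed.

Ltac middle_gap :=
  (apply psi_middle_gap || apply chi_middle_gap); try assumption; pose proof m_bounds;
  match goal with
  | |- context [psi ?k _] => pose proof (psi_middle_bounds k ltac:(lra)); lra
  | _ => lra
  end.

Lemma cgap_left_le n : tame (snd n) ->
  at_end kghi (cleft n) - at_end kglo (cleft n) <= at_end kghi n - at_end kglo n.
Proof.
  intros H. pose proof m_bounds.
  destruct n as [[] g]; unfold at_end; cbn [fst snd cleft kglo kghi] in *;
  try middle_gap.
  (* The kinds [Whole] and [Low] remain, whose left part keeps the map [g]. *)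
  - rewrite <- (Rmult_1_l (g (1 - _) - _)).
    apply (tame_compare g 1 (1/4) (1/4) _ _ _ _ H); lra.
  - rewrite <- (Rmult_1_l (g ((2 - m) / 5) - _)).
    apply (tame_compare g 1 (1/10) (1/10) _ _ _ _ H); lra.
Qed.

Lemma cgap_right_le n : tame (snd n) ->
  at_end kghi (cright n) - at_end kglo (cright n) <= at_end kghi n - at_end kglo n.
Proof.
  intros H. pose proof m_bounds.
  destruct n as [[] g]; unfold at_end; cbn [fst snd cright kglo kghi] in *;
  try middle_gap.
  - rewrite <- (Rmult_1_l (g (1 - (7 - m) / 15) - _)).
    apply (tame_compare g 1 (1/4) (1/4) _ _ _ _ H); lra.
  - rewrite <- (Rmult_1_l (g (1 - (8 - m) / 25) - g (1 - (2 - m) / 5))).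
    apply (tame_compare g 1 (1/10) (1/10) _ _ _ _ H); lra.
Qed.

Definition ctree : gap_tree :=
  GapTree cnode (fun n => tame (snd n))
    (at_end klo) (at_end khi) (at_end kglo) (at_end kghi) cleft cright
    tame_cleft tame_cright cleft_lo cleft_hi cright_lo cright_hi
    cgap_pos cgap_le_left cgap_le_right cgap_left_le cgap_right_le
    12 csize_le_gap.

(** * Survivors as points of the Cantor set *)

Inductive digit_map : (R -> R) -> Prop :=
  | digit_psi k : (2 <= k <= 4)%Z -> digit_map (psi (IZR k))
  | digit_chi k : (2 <= k <= 4)%Z -> digit_map (chi (IZR k)).

Fixpoint cantor (k : nat) (x : R) : Prop :=
  m <= x <= 1 - m /\
  match k with
  | O => True
  | S k => exists f y, digit_map f /\ cantor k y /\ x = f y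
  end.

Lemma cantor_bounds k x : cantor k x -> m <= x <= 1 - m.
Proof. destruct k; simpl; tauto. Qed.

(** A [Whole] node reaches the next [Whole] node, and so the next digit map, after two or three
    splits; hence the factor 3. *)
Lemma survives_cantor k : forall n g a, (3 * k <= n)%nat -> tame g ->
  @survives ctree n (Whole, g) a -> exists x, cantor k x /\ a = g x.
Proof.
  pose proof m_bounds.
  assert (Base : forall n g a, tame g -> @survives ctree n (Whole, g) a ->
    exists x, m <= x <= 1 - m /\ a = g x).
  { intros n g a Hg Hs.
    assert (B : g m <= a <= g (1 - m)) by (destruct n; destruct Hs as [B _]; exact B).
    destruct Hg as [Hd Hsurj]. pose proof (conj Hd Hsurj : tame g) as Hg.
    pose proof (tame_increasing g 0 m Hg ltac:(lra) ltac:(lra) ltac:(lra)).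
    pose proof (tame_increasing g (1 - m) 1 Hg ltac:(lra) ltac:(lra) ltac:(lra)).
    destruct (Hsurj a ltac:(lra)) as (x & Hx & ->). exists x. split; [|reflexivity].
    split; apply (tame_le_reg g); (assumption || lra). }
  induction k as [|k IH]; intros n g a Hn Hg Hs.
  - destruct (Base n g a Hg Hs) as (x & Hx & E). exists x. simpl. auto.
  - destruct (Base n g a Hg Hs) as (x & Hx & E).
    assert (Step : forall f n', digit_map f -> tame (fun y => g (f y)) ->
      (3 * k <= n')%nat -> @survives ctree n' (Whole, fun y => g (f y)) a ->
      exists x, cantor (S k) x /\ a = g x).
    { intros f n' Hf Ht Hn' Hs'. destruct (IH n' _ a Hn' Ht Hs') as (y & Hy & Ey).
      exists (f y). split; [|exact Ey]. split; [|exists f, y; auto].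
      assert (U : 0 <= f y <= 1).
      { pose proof (cantor_bounds k y Hy).
        destruct Hf as [j Hj | j Hj]; pose proof (IZR_le 2 j ltac:(lia));
        [apply psi_unit | apply chi_unit]; lra. }
      (* Injectivity of [g] identifies [f y] with [x], so its bounds come from the surviving
         point. *)
      assert (x = f y) as <-; [|exact Hx].
      apply Rle_antisym; apply (tame_le_reg g); (assumption || lra). }
    destruct n as [|[|[|n]]]; [lia..|].
    assert (F0 : (3 * k <= n)%nat) by lia. assert (F1 : (3 * k <= S n)%nat) by lia.
    destruct Hs as [_ [Hs | Hs]]; cbn -[survives Z.le] in Hs;
    destruct Hs as [_ [Hs | Hs]]; cbn -[survives Z.le] in Hs.
    + destruct Hs as [_ [Hs | Hs]]; cbn -[survives] in Hs.
      * apply (Step (psi 4) _ (digit_psi 4 ltac:(lia)) (tame_psi g 4 ltac:(lra) Hg) F0 Hs).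
      * apply (Step (psi 3) _ (digit_psi 3 ltac:(lia)) (tame_psi g 3 ltac:(lra) Hg) F0 Hs).
    + apply (Step (psi 2) _ (digit_psi 2 ltac:(lia)) (tame_psi g 2 ltac:(lra) Hg) F1 Hs).
    + apply (Step (chi 2) _ (digit_chi 2 ltac:(lia)) (tame_chi g 2 ltac:(lra) Hg) F1 Hs).
    + destruct Hs as [_ [Hs | Hs]]; cbn -[survives] in Hs.
      * apply (Step (chi 3) _ (digit_chi 3 ltac:(lia)) (tame_chi g 3 ltac:(lra) Hg) F0 Hs).
      * apply (Step (chi 4) _ (digit_chi 4 ltac:(lia)) (tame_chi g 4 ltac:(lra) Hg) F0 Hs).
Qed.

Lemma cantor_flip k : forall x, cantor k x -> cantor k (1 - x).
Proof.
  induction k as [|k IH]; intros x [Hx H]; (split; [lra|]); [exact I|].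
  destruct H as (f & y & Hf & Hy & ->). destruct Hf as [j Hj | j Hj].
  - exists (chi (IZR j)), (1 - y). repeat split; auto using digit_chi.
    rewrite chi_flip. do 2 f_equal. ring.
  - exists (psi (IZR j)), (1 - y). repeat split; auto using digit_psi.
    rewrite chi_flip. ring.
Qed.

(** * Nearest-integer expansions *)

Lemma nearest_int_add (q : Z) z : -1/2 <= z < 1/2 -> nearest_int (IZR q + z) = q.
Proof.
  intros Hz. unfold nearest_int. apply Zfloor_eq. lra.
Qed.

Lemma nearest_int_between (q : Z) z :
  0 <= z <= 1 -> (q <= nearest_int (IZR q + z) <= q + 1)%Z.
Proof.
  intros Hz. destruct (Rlt_or_le z (1/2)) as [h | h].
  - rewrite nearest_int_add by lra. lia.
  - replace (IZR q + z) with (IZR (q + 1) + (z - 1)) by (rewrite plus_IZR; ring).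
    rewrite nearest_int_add by lra. lia.
Qed.

(** [nicf_rem] recurses on the last step of the expansion; this peels off the first one. *)
Lemma nicf_rem_shift x i : x <> IZR (nearest_int x) ->
  nicf_rem x (S i) = nicf_rem (1 / (x - IZR (nearest_int x))) i.
Proof.
  intros Hx. induction i as [|i IH].
  - simpl. destruct (Req_EM_T _ _); [contradiction | reflexivity].
  - change (nicf_rem x (S (S i))) with
      (match nicf_rem x (S i) with
       | Some y => if Req_EM_T y (IZR (nearest_int y)) then None
                   else Some (1 / (y - IZR (nearest_int y)))
       | None => None end).
    rewrite IH. reflexivity.
Qed.

Lemma nicf_digit_step (q : Z) z w i : -1/2 <= z < 1/2 -> z * w = 1 ->
  nicf_digit (IZR q + z) (S i) = nicf_digit w i.
Proof.
  intros Hz Hw. assert (z <> 0) by (intros ->; lra).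
  unfold nicf_digit. rewrite nicf_rem_shift; rewrite nearest_int_add by assumption.
  - do 2 f_equal. apply (Rmult_eq_reg_l z); [|assumption]. rewrite Hw. field. lra.
  - lra.
Qed.

(** The reciprocal of [psi j y] is [j + (1 - y)]. The number [chi j y] rounds up to 1, and the
    remainder [- 1 / (j + y)] has reciprocal [(- j - 1) + (1 - y)]. So [p] is in [[2, 4]] or
    [[-5, -3]]. *)
Lemma cantor_next n (q : Z) x : cantor (S n) x ->
  exists (p : Z) y, (-5 <= p <= 4)%Z /\ cantor n y /\
    forall i, nicf_digit (IZR q + x) (S i) = nicf_digit (IZR p + y) i.
Proof.
  intros [Hx (f & y & Hf & Hy & ->)]. pose proof m_bounds.
  pose proof (cantor_bounds n y Hy) as By. pose proof (cantor_flip n y Hy) as Hy'.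
  destruct Hf as [j Hj | j Hj]; pose proof (IZR_le 2 j ltac:(lia)).
  - exists j, (1 - y). split; [lia|]. split; [assumption|]. intros i.
    (* The denominator is at least [2 + m > 2.1], so the fraction is strictly below 1/2 and the
       rounding is unambiguous. *)
    pose proof (inv_bounds 2.1 (IZR j + 1 - y) (IZR j + 1 - y) ltac:(lra) ltac:(lra)).
    apply nicf_digit_step; unfold psi in *; [lra | field; lra].
  - exists (- j - 1)%Z, (1 - y). split; [lia|]. split; [assumption|]. intros i.
    replace (IZR q + chi (IZR j) y) with (IZR (q + 1) + - (1 / (IZR j + y)))
      by (unfold chi; rewrite plus_IZR; ring).
    pose proof (inv_bounds 2.1 (IZR j + y) (IZR j + y) ltac:(lra) ltac:(lra)).
    pose proof (Rdiv_lt_0_compat 1 (IZR j + y) ltac:(lra) ltac:(lra)).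
    apply nicf_digit_step; [lra|]. rewrite minus_IZR, opp_IZR. field. lra.
Qed.

Lemma cantor_digits n : forall (q : Z) x i d, cantor n x -> (1 <= i <= n)%nat ->
  nicf_digit (IZR q + x) i = Some d -> (Z.abs d <= 5)%Z.
Proof.
  induction n as [|n IH]; intros q x i d Hx Hi Hd; [lia|].
  destruct i as [|i]; [lia|].
  destruct (cantor_next n q x Hx) as (p & y & Hp & Hy & E). rewrite E in Hd.
  destruct i as [|i].
  (* The digit is [p] or [p + 1], so the asymmetric range [-5 <= p <= 4] gives exactly the bound
     5. *)
  - injection Hd as <-. pose proof (cantor_bounds n y Hy). pose proof m_bounds.
    pose proof (nearest_int_between p y ltac:(lra)). lia.
  - apply (IH p y (S i) d Hy); [lia | assumption].
Qed.

Lemma survivor_NICF a : (forall k, @survives ctree k (Whole, fun x => x) a) -> NICF 5 a.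
Proof.
  intros H i d Hi Hd.
  destruct (survives_cantor i (3 * i) _ a (le_n _) tame_id (H _)) as (x & Hx & ->).
  apply (cantor_digits i 0 x i d Hx); [lia|]. now rewrite Rplus_0_l.
Qed.

Theorem theorem5p8 (x : R) (hx : 1 / 2 <= x <= 3 / 2) :
  exists a b : R, NICF 5 a /\ NICF 5 b /\ a + b = x.
Proof.
  destruct (@sum_of_survivors ctree x (Whole, fun x => x) (Whole, fun x => x))
    as (a & b & Ha & Hb & E).
  (* The sum of two copies of [[m, 1 - m]] is [[2 * m, 2 - 2 * m]], which contains [[1/2, 3/2]]
     because [m < 1/4]. *)
  - pose proof m_bounds. unfold linked, gap, len. simpl. unfold at_end. simpl.
    repeat split; try apply tame_id; lra.
  - exists a, b. auto using survivor_NICF.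
Qed.
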